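(* Let $n\ge 2$. The maps $\Gamma$ from the set of triangulations of $C(n+2,3)$ to the set of persistent graphs on vertex set $[n]$, and $\Xi$ from the set of persistent graphs on $[n]$ to the set of triangulations of $C(n+2,3)$, are well defined and mutually inverse bijections.
   Context: The cyclic polytope $C(n+2,3)$ is the convex hull of $n+2$ points on the moment curve $t\mapsto(t,t^2,t^3)$, with vertices labelled $0,\dots,n+1$ in increasing order of the parameter; simplices and faces are identified with their vertex sets. A triangulation is a set $T$ of 3-simplices (4-element vertex subsets) whose convex hulls cover the polytope and pairwise intersect in a common (possibly empty) face; $F_1(T)$ denotes the set of 2-element sets contained in some simplex of $T$. $\Gamma(T)=([n],F_1(T)\cap\binom{[n]}{2})$. A graph $G=([n],E)$ is persistent if (1) $\{i,i+1\}\in E$ for all $1\le i<n$; (2) (X-property) if $\{a,c\},\{b,d\}\in E$ for $a<b<c<d$ then $\{a,d\}\in E$; (3) (bar-property) for every edge $\{a,b\}\in E$ with $a<b-1$ there is $x$ with $a<x<b$ and $\{a,x\},\{x,b\}\in E$. $\hat G$ is the graph on $\{0,\dots,n+1\}$ with edge set $E$ together with all pairs containing $0$ or $n+1$. For $e=\{v,w\}\in E$ with $v<w$, $\ell_G(e)=\max\{i : i<v,\ \{i,w\}\in E(\hat G)\}$, $r_G(e)=\min\{i : w<i,\ \{i,v\}\in E(\hat G)\}$, $\xi_G(e)=\{\ell_G(e),v,w,r_G(e)\}$, and $\Xi(G)=\{\xi_G(e): e\in E\}$. *)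

(* Defs.v *)
From HB Require Import structures.
From mathcomp Require Import all_boot all_order all_algebra.
From mathcomp Require Import reals.
Set Implicit Arguments. Unset Strict Implicit. Unset Printing Implicit Defensive.
Import Order.TTheory GRing.Theory Num.Theory.

(* Vertices of C(n+2,3) are 0,...,n+1, i.e. the type 'I_(n.+2). *)

Section Geometry.
Variable R : realType.
Local Open Scope ring_scope.
Variable n : nat.

Definition moment_pt (t : 'I_(n.+2) -> R) (i : 'I_(n.+2)) : 'rV[R]_3 :=
  \row_(j < 3) (t i) ^+ j.+1.

Definition in_conv (t : 'I_(n.+2) -> R) (S : {set 'I_(n.+2)}) (x : 'rV[R]_3) : Prop :=
  exists lam : 'I_(n.+2) -> R,
    [/\ forall i, (0 <= lam i)%R,
        forall i, i \notin S -> lam i = 0%R,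
        (\sum_i lam i = 1)%R
      & x = (\sum_i lam i *: moment_pt t i)%R].

(* T is a triangulation of C(n+2,3) = conv of all the points:
   - T consists of 3-simplices (4-element vertex sets);
   - their convex hulls cover the polytope;
   - any two of them intersect in a common (possibly empty) face, i.e. in the
     convex hull of a common subset of their vertices. *)
Definition triangulation (t : 'I_(n.+2) -> R) (T : {set {set 'I_(n.+2)}}) : Prop :=
  [/\ forall S, S \in T -> #|S| = 4,
      forall x, in_conv t [set: 'I_(n.+2)] x -> exists2 S, S \in T & in_conv t S x
    & forall S1 S2, S1 \in T -> S2 \in T ->
        exists2 A : {set 'I_(n.+2)}, A \subset S1 :&: S2 &
          forall x, (in_conv t S1 x /\ in_conv t S2 x) <-> in_conv t A x].
End Geometry.

Section Graphs.
Variable n : nat.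
Local Notation V := ('I_(n.+2)).

Definition inner (i : V) : bool := (0 < i)%N && (i <= n)%N.

Definition Gamma (T : {set {set V}}) : {set {set V}} :=
  [set e : {set V} | [&& #|e| == 2, e \subset [pred i | inner i]
                       & [exists S in T, e \subset S]]].

Definition graph_on (E : {set {set V}}) : Prop :=
  forall e, e \in E -> #|e| = 2 /\ e \subset [pred i | inner i].

Definition persistent (E : {set {set V}}) : Prop :=
  [/\ graph_on E,
      forall i j : V, (1 <= i)%N -> (i < n)%N -> val j = i.+1 -> [set i; j] \in E,
      forall a b c d : V, (a < b)%N -> (b < c)%N -> (c < d)%N ->
        [set a; c] \in E -> [set b; d] \in E -> [set a; d] \in E
    &
      forall a b : V, (a.+1 < b)%N -> [set a; b] \in E ->
        exists x : V, [/\ (a < x)%N, (x < b)%N, [set a; x] \in E & [set x; b] \in E]].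

Definition hat_adj (E : {set {set V}}) (i j : V) : bool :=
  (i != j) && [|| [set i; j] \in E, val i == 0%N, val j == 0%N,
                  val i == n.+1 | val j == n.+1].

Definition lG (E : {set {set V}}) (v w : V) : V :=
  [arg max_(i > (ord0 : V) | (i < v)%N && hat_adj E i w) val i].

Definition rG (E : {set {set V}}) (v w : V) : V :=
  [arg min_(i < (ord_max : V) | (w < i)%N && hat_adj E i v) val i].

Definition xi (E : {set {set V}}) (v w : V) : {set V} :=
  [set lG E v w; v; w; rG E v w].

Definition Xi (E : {set {set V}}) : {set {set V}} :=
  [set X : {set V} | [exists v : V, exists w : V,
      [&& (v < w)%N, [set v; w] \in E & X == xi E v w]]].
End Graphs.

Arguments inner n i : clear implicits.
Arguments Gamma n T : clear implicits.
Arguments graph_on n E : clear implicits.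
Arguments persistent n E : clear implicits.
Arguments hat_adj n E i j : clear implicits.
Arguments lG n E v w : clear implicits.
Arguments rG n E v w : clear implicits.
Arguments xi n E v w : clear implicits.
Arguments Xi n E : clear implicits.

(* Main.v *)
(* By Descartes' rule of signs, the minimal affine dependences between points of
   the moment curve are the circuits (ace | bd) with a < b < c < d < e, so two
   simplices meet in a common face unless a triangle ace of one is pierced by an
   edge bd of the other.
   Given a triangulation T, the midpoint of bd lies in some simplex, so bd is an
   edge of T or is pierced by a triangle of T; this yields the X-property. Points
   close to the barycenter of a triangle abc of T, on either side of its plane,
   yield a cofacet on that side unless abc is a boundary facet; applied to the
   triangles on an edge vw with extremal third vertex, this gives the bar-property
   and a simplex with middle vertices v and w, which must be xi(v,w).
   Given a persistent graph, any triangle whose sides are edges and which is not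
   pierced is, unless it is an upper boundary facet, a lower facet of a simplex
   xi(v,w). A point of the polytope is thus found in a simplex by walking up a
   vertical line, from the lower boundary, through a chain of simplices. *)
Require Import Defs.
From HB Require Import structures.
From mathcomp Require Import all_boot all_order all_algebra.
From mathcomp Require Import boolp reals.
From mathcomp Require Import zify ring lra.
Import Order.TTheory GRing.Theory Num.Theory.

Set Implicit Arguments.
Unset Strict Implicit.
Unset Printing Implicit Defensive.

(** * Finite ordinals: extremal elements, sorting, a common radius *)

Lemma ex_min_ord m (P : pred 'I_m) : (exists i, P i) ->
  exists2 i, P i & forall j : 'I_m, P j -> (i <= j)%N.
Proof.
case=> i0 Pi0; have [i Pi le_i] := arg_minnP (fun i : 'I_m => val i) Pi0.
by exists i.
Qed.

Lemma ex_max_ord m (P : pred 'I_m) : (exists i, P i) ->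
  exists2 i, P i & forall j : 'I_m, P j -> (j <= i)%N.
Proof.
case=> i0 Pi0; have [i Pi le_i] := arg_maxnP (fun i : 'I_m => val i) Pi0.
by exists i.
Qed.

Lemma set_min_ord m (S : {set 'I_m}) k : #|S| = k.+1 ->
  exists a, [/\ S = a |: S :\ a, #|S :\ a| = k & forall j, j \in S :\ a -> (a < j)%N].
Proof.
move=> Sk; have [a aS amin] : exists2 i : 'I_m, i \in S & forall j, j \in S -> (i <= j)%N.
  by apply: (@ex_min_ord m (mem S)); apply/set0Pn; rewrite -cards_eq0 Sk.
exists a; rewrite setD1K //; split=> //; first by move: Sk; rewrite (cardsD1 a) aS => -[].
move=> j; rewrite !inE => /andP[ja /amin]; rewrite leq_eqVlt => /orP[/eqP e|//].
by rewrite (val_inj e) eqxx in ja.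
Qed.

Lemma sort_set4 m (S : {set 'I_m}) : #|S| = 4 -> exists a b c d : 'I_m,
  [/\ (a < b)%N, (b < c)%N, (c < d)%N & S = [set a; b; c; d]].
Proof.
move=> /set_min_ord[a [eS /set_min_ord[b [eS1 /set_min_ord[c [eS2]]]]]].
move=> /eqP/cards1P[d eS3] cmin bmin amin.
exists a, b, c, d; split.
- by apply: amin; rewrite eS1 setU11.
- by apply: bmin; rewrite eS2 setU11.
- by apply: cmin; rewrite eS3 set11.
- by rewrite eS eS1 eS2 eS3; apply/setP => i; rewrite !inE !orbA.
Qed.

(** Serves [tri_cofacet], where one small perturbation has to work for all simplices of the
    triangulation at once. *)
Lemma common_radius (R : realDomainType) (I : eqType) (s : seq I) (P : I -> R -> Prop) :
  (forall i, i \in s -> exists2 d : R, (0 < d)%R & forall e, (0 < e < d)%R -> P i e) ->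
  exists2 d : R, (0 < d)%R & forall i, i \in s -> forall e, (0 < e < d)%R -> P i e.
Proof.
elim: s => [_|i s IHs h]; first by exists 1%R; rewrite ?ltr01.
have [j js|d d0 hd] := IHs; first by apply: h; rewrite inE js orbT.
have [d' d'0 hd'] := h i (mem_head _ _).
exists (Num.min d d'); first by rewrite lt_min d0.
move=> j; rewrite inE => /orP[/eqP->|js] e /andP[e0]; rewrite lt_min => /andP[ed ed'].
  by apply: hd'; rewrite e0.
by apply: hd js _ _; rewrite e0.
Qed.

Lemma cards4_lt m (a b c d : 'I_m) :
  (a < b)%N -> (b < c)%N -> (c < d)%N -> #|[set a; b; c; d]| = 4.
Proof.
move=> ab bc cd; rewrite (_ : [set a; b; c; d] = [set x in [:: a; b; c; d]]).
  by rewrite cardsE; apply/card_uniqP; rewrite /= !inE -!val_eqE /=; lia.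
by apply/setP => i; rewrite !inE !orbA.
Qed.

(** * Persistent graphs *)

Section HatGraph.
Variables (n : nat) (E : {set {set 'I_(n.+2)}}).
Local Notation V := 'I_(n.+2).
Local Notation H := (hat_adj n E).
Implicit Types a b c d i v w x y z : V.

Lemma hat_sym x y : H x y = H y x.
Proof.
rewrite /hat_adj eq_sym setUC; congr (_ && _); congr (_ || _).
by rewrite orbCA; do 2!congr (_ || _); rewrite orbC.
Qed.

Lemma hat0 x y : (x < y)%N -> x = 0 :> nat -> H x y.
Proof.
by move=> xy e; rewrite /hat_adj -val_eqE /= (ltn_eqF xy) e eqxx !orbT.
Qed.

Lemma hat_last x y : (x < y)%N -> y = n.+1 :> nat -> H x y.
Proof.
by move=> xy e; rewrite /hat_adj -val_eqE /= (ltn_eqF xy) e eqxx !orbT.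
Qed.

Lemma hat_inner x y : (0 < x)%N -> (x < y)%N -> (y <= n)%N -> H x y = ([set x; y] \in E).
Proof.
move=> x0 xy yn; rewrite /hat_adj -val_eqE /=; set e := _ \in E.
have -> : (x == y :> nat) = false by lia.
have -> : (x == 0 :> nat) = false by lia.
have -> : (y == 0 :> nat) = false by lia.
have -> : (x == n.+1 :> nat) = false by lia.
have -> : (y == n.+1 :> nat) = false by lia.
by rewrite !orbF.
Qed.

Lemma hat_cases x y : (x < y)%N ->
  [\/ x = 0 :> nat, y = n.+1 :> nat | (0 < x)%N /\ (y <= n)%N].
Proof.
move=> xy; have := ltn_ord y; have [?|x0] := posnP x; first by constructor 1.
rewrite ltnS leq_eqVlt => /orP[/eqP?|?]; first by constructor 2.
by constructor 3.
Qed.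

(** The default index [ord0] of the arg max is itself a candidate, since 0 < v and 0 is joined to
    everything; hence the arg max is the true maximum. *)
Lemma lGP v w : (0 < v)%N -> (v < w)%N ->
  [/\ (lG n E v w < v)%N, H (lG n E v w) w
    & forall i : V, (i < v)%N -> H i w -> (i <= lG n E v w)%N].
Proof.
move=> v0 vw; rewrite /lG; case: arg_maxnP => [|i /andP[iv iw] imax].
  by rewrite v0 hat0 // (leq_trans _ vw).
by split=> // j jv jw; apply: imax; rewrite jv.
Qed.

Lemma rGP v w : (v < w)%N -> (w <= n)%N ->
  [/\ (w < rG n E v w)%N, H v (rG n E v w)
    & forall i : V, (w < i)%N -> H v i -> (rG n E v w <= i)%N].
Proof.
move=> vw wn; rewrite /rG; case: arg_minnP => [|i /andP[iv iw] imin].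
  by rewrite /= ltnS wn hat_sym hat_last //= (leq_trans vw) // leqW.
by rewrite hat_sym; split=> // j jv jw; apply: imin; rewrite jv hat_sym.
Qed.

Lemma xi_eq a b c d : (a < b)%N -> (b < c)%N -> (c < d)%N -> H a c -> H b d ->
  (forall i, (a < i)%N -> (i < b)%N -> H i c -> False) ->
  (forall i, (c < i)%N -> (i < d)%N -> H b i -> False) ->
  xi n E b c = [set a; b; c; d].
Proof.
move=> ab bc cd ac bd amax dmin.
have b0 : (0 < b)%N by apply: leq_trans ab.
have cn : (c <= n)%N by rewrite -ltnS (leq_trans cd) // -ltnS.
have [lb lc lmax] := lGP b0 bc; have [rc rb rmin] := rGP bc cn.
rewrite /xi; suff [-> ->] : lG n E b c = a /\ rG n E b c = d by [].
split; apply: val_inj; apply/eqP; rewrite eqn_leq.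
  rewrite lmax // andbT leqNgt; apply/negP => h; exact: amax h lb lc.
by rewrite rmin //= leqNgt; apply/negP => h; exact: dmin rc h rb.
Qed.

Lemma XiP S : graph_on n E -> S \in Xi n E ->
  exists a b c d, [/\ [/\ (a < b)%N, (b < c)%N & (c < d)%N], S = [set a; b; c; d],
    [/\ H b c, H a c & H b d],
    forall i, (a < i)%N -> (i < b)%N -> H i c -> False
    & forall i, (c < i)%N -> (i < d)%N -> H b i -> False].
Proof.
move=> gE; rewrite inE => /existsP[v /existsP[w /and3P[vw vwE /eqP ->]]].
have [_ /subsetP inn] := gE _ vwE.
have /andP[v0 vn] : inner n v by apply: inn; rewrite !inE eqxx.
have /andP[w0 wn] : inner n w by apply: inn; rewrite !inE eqxx orbT.
have [lv lw lmax] := lGP v0 vw; have [rw rv rmin] := rGP vw wn.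
exists (lG n E v w), v, w, (rG n E v w); split=> //.
- by split=> //; rewrite hat_inner.
- by move=> i il iv /(lmax _ iv); rewrite leqNgt il.
- by move=> i il iv /(rmin _ il); rewrite leqNgt iv.
Qed.

Lemma mem_Xi a b c d : (a < b)%N -> (b < c)%N -> (c < d)%N ->
  H b c -> H a c -> H b d ->
  (forall i, (a < i)%N -> (i < b)%N -> H i c -> False) ->
  (forall i, (c < i)%N -> (i < d)%N -> H b i -> False) ->
  [set a; b; c; d] \in Xi n E.
Proof.
move=> ab bc cd hbc ac bd amax dmin.
have b0 : (0 < b)%N by apply: leq_trans ab.
have cn : (c <= n)%N by rewrite -ltnS (leq_trans cd) // -ltnS.
rewrite inE; apply/existsP; exists b; apply/existsP; exists c.
by rewrite bc -hat_inner // hbc (xi_eq ab bc cd ac bd amax dmin) eqxx.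
Qed.

(** * Edges of the simplices of a persistent graph *)

Section Persistent.
Hypothesis Epers : persistent n E.

Lemma pers_graph : graph_on n E. Proof. by case: Epers. Qed.

Lemma hat_next x y : y = x.+1 :> nat -> H x y.
Proof.
move=> xy; have lxy : (x < y)%N by rewrite xy.
case: (hat_cases lxy) => [?|?|[x0 yn]]; [exact: hat0|exact: hat_last|].
by rewrite hat_inner //; case: Epers => _ h _ _; apply: h => //; rewrite -xy.
Qed.

(** The X-property and, below, the bar-property extend to the hat graph, so that 0 and n+1 need no
    separate treatment later. Here the conclusion is free if a = 0 or d = n+1, and otherwise all
    four vertices are inner. *)
Lemma hat_X a b c d : (a < b)%N -> (b < c)%N -> (c < d)%N -> H a c -> H b d -> H a d.
Proof.
move=> ab bc cd; have ad := ltn_trans ab (ltn_trans bc cd).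
case: (hat_cases ad) => [?|?|[a0 dn]]; [by move=> *; exact: hat0|by move=> *; exact: hat_last|].
rewrite !hat_inner //; try lia.
by case: Epers => _ _ h _; apply: h.
Qed.

Lemma hat_bar a b : (a.+1 < b)%N -> H a b ->
  exists x, [/\ (a < x)%N, (x < b)%N, H a x & H x b].
Proof.
(* For an edge at 0 the intermediate vertex is b-1, for an edge at n+1 it is a+1; consecutive
   vertices are always joined. *)
move=> ab; have ab' := ltnW ab; have lb := ltn_ord b.
case: (hat_cases ab') => [a0 _|bn _|[a0 bn]].
- exists (inord b.-1); have e : (inord b.-1 : V) = b.-1 :> nat by rewrite inordK //; lia.
  split; rewrite ?e; try lia; first by apply: hat0; rewrite ?e //; lia.
  by apply: hat_next; rewrite e; lia.
- exists (inord a.+1); have e : (inord a.+1 : V) = a.+1 :> nat by rewrite inordK //; lia.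
  split; rewrite ?e //; first exact: hat_next.
  by apply: hat_last; rewrite ?e //; lia.
- rewrite hat_inner // => abE; have [_ _ _ /(_ _ _ ab abE)] := Epers; move=> [x [ax xb axE xbE]].
  by exists x; split; rewrite // hat_inner //; lia.
Qed.

(* The hypotheses on a say that a = l(bc); dually below for d = r(bc). *)
Lemma xi_left a b c : (a < b)%N -> (b < c)%N -> H b c -> H a c ->
  (forall i, (a < i)%N -> (i < b)%N -> H i c -> False) -> H a b.
Proof.
move=> ab bc hbc hac amax.
(* Let x be the least neighbour of a in [b, c]. If x > b, the bar-property splits ax at some y.
   Minimality of x excludes y > b; if y < b, then yx and bc give the edge yc (which is yx itself
   when x = c), against the choice of a. *)
have [|x /and3P[bx xc ax] xmin] := @ex_min_ord _ (fun x : V => [&& (b <= x)%N, (x <= c)%N & H a x]).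
  by exists c; rewrite leqnn hac ltnW.
have [/val_inj <-//|bx'] := eqVneq (nat_of_ord x) (nat_of_ord b).
have {bx bx'} bx : (b < x)%N by rewrite ltn_neqAle bx andbT eq_sym.
have [|y [ay yx hay hyx]] := hat_bar _ ax; first lia.
case: (ltngtP y b) => [yb|b_y|/val_inj <- //].
  have [/val_inj xc'|xc'] := eqVneq (nat_of_ord x) (nat_of_ord c);
    first by rewrite xc' in hyx; case: (amax y).
  have {}xc : (x < c)%N by rewrite ltn_neqAle xc'.
  by case: (amax y ay yb); apply: hat_X hyx hbc.
have := xmin y; rewrite hay (ltnW b_y) /= andbT; lia.
Qed.

Lemma xi_right b c d : (b < c)%N -> (c < d)%N -> H b c -> H b d ->
  (forall i, (c < i)%N -> (i < d)%N -> H b i -> False) -> H c d.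
Proof.
move=> bc cd hbc hbd dmin.
have [|x /and3P[bx xc xd] xmax] := @ex_max_ord _ (fun x : V => [&& (b <= x)%N, (x <= c)%N & H x d]).
  by exists b; rewrite leqnn hbd ltnW.
have [/val_inj <-//|xc'] := eqVneq (nat_of_ord x) (nat_of_ord c).
have {xc xc'} xc : (x < c)%N by rewrite ltn_neqAle xc'.
have [|y [xy yd hxy hyd]] := hat_bar _ xd; first lia.
case: (ltngtP y c) => [yc|cy|/val_inj <- //].
  have := xmax y; rewrite hyd /=; lia.
have [/val_inj bx'|bx'] := eqVneq (nat_of_ord b) (nat_of_ord x);
  first by rewrite -bx' in hxy; case: (dmin y).
have {}bx : (b < x)%N by rewrite ltn_neqAle bx'.
by case: (dmin y cy yd); apply: hat_X hbc hxy.
Qed.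

(** Three sides come with the definition of xi, ab and cd from the two preceding lemmas, and ad from
    the X-property for ac and bd. *)
Lemma Xi_edges S x y : S \in Xi n E -> x \in S -> y \in S -> (x < y)%N -> H x y.
Proof.
move=> /(XiP pers_graph)[a [b [c [d [[ab bc cd] -> [hbc hac hbd] amax dmin]]]]].
have hab := xi_left ab bc hbc hac amax; have hcd := xi_right bc cd hbc hbd dmin.
have had := hat_X ab bc cd hac hbd.
rewrite !inE -!orbA => /or4P[] /eqP -> /or4P[] /eqP -> //; lia.
Qed.

Lemma Xi_noncrossing S x y : S \in Xi n E -> H x y -> (x < y)%N ->
  forall a b c, a \in S -> b \in S -> c \in S ->
  (a < x)%N -> (x < b)%N -> (b < y)%N -> (y < c)%N -> False.
Proof.
move=> /(XiP pers_graph)[l [v [w [r [[lv vw wr] -> [hvw hlw hvr] lmax rmin]]]]].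
(* Induction on the length of pq. If p < v and w < q, the bar-property yields z: outside [v, w] it
   leaves a shorter edge of the same kind, and inside it produces pw or vq. If only one inequality
   holds, the X-property with vw produces pw or vq, unless pq already is such an edge. Either one
   contradicts the extremality of l or r. *)
have no_edge k (p q : V) : (q - p <= k)%N -> H p q -> (l < p)%N -> (p < w)%N -> (v < q)%N ->
    (q < r)%N -> (p < v)%N || (w < q)%N -> False.
  elim: k p q => [|k IHk] p q qpk hpq lp pw vq qr => [|pvwq]; first lia.
  have pq : (p < q)%N by lia.
  move: pvwq; case: (ltnP p v) => pv /=; case: (ltnP w q) => wq // _.
  - have [|z [pz zq hpz hzq]] := hat_bar _ hpq; first lia.
    have [zv|vz] := ltnP z v; first by apply: (IHk z q) => //; rewrite ?zv; lia.
    have [wz|zw] := ltnP w z; first by apply: (IHk p z) => //; rewrite ?wz ?orbT; lia.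
    have [/val_inj zv|zv] := eqVneq (nat_of_ord z) (nat_of_ord v).
      by rewrite zv in hzq; case: (rmin q).
    have [/val_inj zw'|zw'] := eqVneq (nat_of_ord z) (nat_of_ord w).
      by rewrite zw' in hpz; case: (lmax p).
    case: (lmax p lp pv); apply: hat_X hpz hvw; lia.
  - have [/val_inj qw|qw] := eqVneq (nat_of_ord q) (nat_of_ord w).
      by rewrite qw in hpq; case: (lmax p).
    case: (lmax p lp pv); apply: hat_X hpq hvw; lia.
  - have [/val_inj pv'|pv'] := eqVneq (nat_of_ord p) (nat_of_ord v).
      by rewrite pv' in hpq; case: (rmin q).
    case: (rmin q wq qr); apply: hat_X hvw hpq; lia.
(* The vertex b between x and y can only be v or w, so a piercing edge is of the excluded kind. *)
move=> hxy xy a b c; rewrite !inE -!orbA => ha hb hc ax xb by_ yc.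
have lw := ltn_trans lv vw; have vr := ltn_trans vw wr; have lr := ltn_trans lv vr.
have la : (l <= a)%N by case/or4P: ha => /eqP->; rewrite ?leqnn ?(ltnW lv) ?(ltnW lw) ?(ltnW lr).
have cr : (c <= r)%N by case/or4P: hc => /eqP->; rewrite ?leqnn ?(ltnW vr) ?(ltnW wr) ?(ltnW lr).
apply: (no_edge _ x y (leqnn _) hxy); clear no_edge lmax rmin ha hc;
  by case/or4P: hb => /eqP e; subst b; lia.
Qed.

(** * Unpierced triangles and the simplices above them *)

Definition unpierced a b c : Prop :=
  [/\ (a < b)%N /\ (b < c)%N, H a b, H b c, H a c &
      forall x y, (a < x)%N -> (x < b)%N -> (b < y)%N -> (y < c)%N -> H x y -> False].

Lemma unpierced_face S a b c : S \in Xi n E -> a \in S -> b \in S -> c \in S ->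
  (a < b)%N -> (b < c)%N -> unpierced a b c.
Proof.
move=> SX aS bS cS ab bc; have ac := ltn_trans ab bc.
split; rewrite ?(Xi_edges SX) //.
move=> x y ax xb by_ yc hxy.
exact: (Xi_noncrossing SX hxy (ltn_trans xb by_) aS bS cS).
Qed.

(** These are the lower facets of the polytope, where the upward walk starts; no y lies strictly
    between i and i+1. *)
Lemma unpierced_bottom i (j : V) : (0 < i)%N -> j = i.+1 :> nat -> unpierced ord0 i j.
Proof.
move=> i0 ij; split; last by move=> x y _ _; lia.
- by rewrite ij leqnn.
- exact: hat0.
- exact: hat_next.
- by apply: hat0; rewrite ?ij.
Qed.

(* Unless abc is an upper facet of the polytope, there is a simplex above it. *)
Lemma unpierced_lift a b c v : unpierced a b c -> (c < v)%N || (a < v < b)%N ->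
  (exists2 z : V, (c < z)%N & [set a; b; c; z] \in Xi n E) \/
  (exists2 z : V, (a < z)%N && (z < b)%N & [set a; z; b; c] \in Xi n E).
Proof.
move=> [[ab bc] hab hbc hac np] hv; have lc := ltn_ord c.
have b0 : (0 < b)%N by apply: leq_trans ab.
(* If c has neighbours in (a, b), the largest one, x, is joined to b: the bar-property on xc can
   only give b itself. The least z in (a, b) joined to b is then joined to c by the X-property, and
   the simplex is xi(z, b). *)
have [/existsP ex|] := boolP [exists x : V, [&& (a < x)%N, (x < b)%N & H x c]].
  have [x /and3P[ax xb hxc] xmax] := ex_max_ord ex.
  have hxb : H x b.
    have [|y [xy yc hxy hyc]] := hat_bar _ hxc; first by lia.
    case: (ltngtP y b) => [yb|b_y|/val_inj <- //]; last by case: (np x y).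
    by have := xmax y; rewrite yb hyc (ltn_trans ax xy) => /(_ isT); lia.
  have [|z /and3P[az zb hzb] zmin] :=
      @ex_min_ord _ (fun x : V => [&& (a < x)%N, (x < b)%N & H x b]).
    by exists x; rewrite ax xb.
  have hzc : H z c.
    have := zmin x; rewrite ax xb hxb => /(_ isT); rewrite leq_eqVlt => /orP[/eqP e|zx].
      by rewrite (val_inj e).
    exact: hat_X zx xb bc hzb hxc.
  right; exists z; first by rewrite az.
  apply: mem_Xi => // [i ai iz hib|i bi ic hzi]; last exact: (np z i).
  by have := zmin i; rewrite ai hib (ltn_trans iz) // => /(_ isT); lia.
rewrite negb_exists => /forallP nex.
(* Now a = l(bc), and the simplex is xi(b, c) once c is inner. If c were n+1, then b-1 would be a
   neighbour of c; it lies in (a, b) because [hv] makes that interval nonempty. *)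
have cn : (c <= n)%N.
  rewrite leqNgt; apply/negP => cn; have ec : c = n.+1 :> nat by lia.
  have e : (inord b.-1 : V) = b.-1 :> nat by rewrite inordK //; lia.
  have := nex (inord b.-1); rewrite e (hat_last _ ec) ?e; last lia.
  by have := ltn_ord v; lia.
have [cr hbr rmin] := rGP bc cn.
left; exists (rG n E b c) => //; apply: mem_Xi => //.
  by move=> i ai ib hic; have := nex i; rewrite ai ib hic.
by move=> i ci ir /(rmin _ ci); lia.
Qed.

Lemma Gamma_Xi : Gamma n (Xi n E) = E.
Proof.
apply/setP => e; apply/idP/idP.
  rewrite inE => /and3P[/cards2P[x [y [xy ->]]] /subsetP inn /existsP[S /andP[SX /subsetP sub]]].
  have /andP[x0 xn] : inner n x by apply: inn; rewrite !inE eqxx.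
  have /andP[y0 yn] : inner n y by apply: inn; rewrite !inE eqxx orbT.
  have xS : x \in S by apply: sub; rewrite !inE eqxx.
  have yS : y \in S by apply: sub; rewrite !inE eqxx orbT.
  case: (ltngtP x y) xy => [xy _|yx _|/val_inj->]; last by rewrite eqxx.
    by rewrite -hat_inner // (Xi_edges SX).
  by rewrite setUC -hat_inner // (Xi_edges SX).
move=> eE; have [/eqP e2 inn] := pers_graph eE; rewrite inE.
apply/and3P; split=> //.
have /cards2P[x [y [xy ee]]] := e2.
wlog lxy : x y xy ee / (x < y)%N => [wl|].
  case: (ltngtP x y) (xy) => [lxy _|lyx _|/val_inj->]; last by rewrite eqxx.
    exact: wl lxy.
  by apply: wl lyx; rewrite // 1?eq_sym // setUC.
apply/existsP; exists (xi n E x y); apply/andP; split.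
  by rewrite inE; apply/existsP; exists x; apply/existsP; exists y; rewrite lxy -ee eE eqxx.
by rewrite ee; apply/subsetP => i; rewrite !inE => /orP[]/eqP->; rewrite eqxx ?orbT.
Qed.

End Persistent.
End HatGraph.

Lemma graph_on_Gamma n T : graph_on n (Gamma n T).
Proof. by move=> e; rewrite inE => /and3P[/eqP-> ->]. Qed.

(** * Geometry of the moment curve *)

Section MomentCurve.
Variables (R : realType) (n : nat) (t : 'I_(n.+2) -> R).
Hypothesis t_lt : forall i j : 'I_(n.+2), (i < j)%N -> (t i < t j)%R.
Local Open Scope ring_scope.
Local Notation V := 'I_(n.+2).
Implicit Types (S A : {set V}) (x y : 'rV[R]_3) (i j : V).

Lemma t_le i j : (i <= j)%N -> t i <= t j.
Proof.
rewrite leq_eqVlt => /orP[/eqP ij|/t_lt/ltW //].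
by rewrite (val_inj ij).
Qed.

(** * Affine functions and barycentric weights *)

Definition px x (k : nat) : R := x ord0 (inord k).

(** On the moment curve this is the cubic polynomial in the parameter with the same coefficients. *)
Definition aff (c0 c1 c2 c3 : R) x : R :=
  c0 + c1 * px x 0 + c2 * px x 1 + c3 * px x 2.

(** The body of [in_conv] with its weights exposed, so that two systems of weights for one point can
    be compared. *)
Definition bary S x (lam : V -> R) : Prop :=
  [/\ forall i, 0 <= lam i, forall i, i \notin S -> lam i = 0,
      \sum_i lam i = 1 & x = \sum_i lam i *: moment_pt t i].

Lemma px_sum (lam : V -> R) k : (k < 3)%N ->
  px (\sum_i lam i *: moment_pt t i) k = \sum_i lam i * t i ^+ k.+1.
Proof.
move=> k3; rewrite /px summxE; apply: eq_bigr => i _.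
by rewrite !mxE inordK.
Qed.

Lemma aff_bary S x lam c0 c1 c2 c3 : bary S x lam ->
  aff c0 c1 c2 c3 x =
  \sum_i lam i * (c0 + c1 * t i + c2 * t i ^+ 2 + c3 * t i ^+ 3).
Proof.
case=> _ _ lam1 ->; rewrite /aff !px_sum // -{1}[c0]mulr1 -lam1 !mulr_sumr.
by rewrite -!big_split; apply: eq_bigr => i _ /=; ring.
Qed.

Lemma row3P x y : (forall k, (k < 3)%N -> px x k = px y k) -> x = y.
Proof.
by move=> xy; apply/rowP=> j; have := xy j (ltn_ord j); rewrite /px inord_val.
Qed.

(** Weights listed as vertex-weight pairs; repeated vertices add up, so [sum_comb] needs no
    distinctness. *)
Definition comb (s : seq (V * R)) i : R :=
  \sum_(p <- s) if i == p.1 then p.2 else 0.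

Lemma sum_comb s (f : V -> R) : \sum_i comb s i * f i = \sum_(p <- s) p.2 * f p.1.
Proof.
rewrite /comb; under eq_bigr do rewrite mulr_suml.
rewrite exchange_big; apply: eq_bigr => p _ /=.
rewrite (bigD1 p.1) //= eqxx big1 ?addr0 // => i /negPf ->.
by rewrite mul0r.
Qed.

Lemma bary_comb S x s :
  all (fun p => (0 <= p.2) && (p.1 \in S)) s ->
  \sum_(p <- s) p.2 = 1 ->
  (forall k, (k < 3)%N -> px x k = \sum_(p <- s) p.2 * t p.1 ^+ k.+1) ->
  bary S x (comb s).
Proof.
move=> /allP s_ok s1 sx; split.
- move=> i; rewrite /comb big_seq; apply: sumr_ge0 => p /s_ok /andP[p0 _].
  by case: ifP.
- move=> i iS; rewrite /comb big_seq big1 // => p /s_ok /andP[_ pS].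
  by case: eqP => // ip; rewrite ip pS in iS.
- have := sum_comb s (fun _ => 1); rewrite /= => e.
  rewrite -s1 -[RHS](eq_bigr _ (fun p _ => mulr1 p.2)) -e.
  by apply: eq_bigr => i _; rewrite mulr1.
- apply: row3P => k k3; rewrite sx // px_sum //.
  by rewrite (sum_comb s (fun i => t i ^+ k.+1)).
Qed.

Lemma sum_ge0_neq0 (F : V -> R) j :
  (forall i, 0 <= F i) -> 0 < F j -> \sum_i F i = 0 -> False.
Proof.
move=> F0 Fj /(psumr_eq0P (fun i _ => F0 i)) /(_ j isT) e.
by rewrite e ltxx in Fj.
Qed.

Lemma sum_le0_neq0 (F : V -> R) j :
  (forall i, F i <= 0) -> F j < 0 -> \sum_i F i = 0 -> False.
Proof.
move=> F0 Fj e; apply: (@sum_ge0_neq0 (fun i => - F i) j).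
- by move=> i; rewrite oppr_ge0.
- by rewrite oppr_gt0.
- by rewrite sumrN e oppr0.
Qed.

(** * Sign changes, crossings and uniqueness of weights *)

Lemma ex_next (P : pred V) (i : V) :
  (forall j, (i < j)%N -> ~~ P j) \/
  exists2 j : V, (i < j)%N & P j /\ forall k : V, (i < k)%N -> (k < j)%N -> ~~ P k.
Proof.
have [/existsP ex|] := boolP [exists j : V, (i < j)%N && P j].
  right; have [j /andP[ij Pj] minj] := ex_min_ord ex; exists j => //; split=> // k ik kj.
  by apply: contraL kj => Pk; rewrite -leqNgt minj // ik.
rewrite negb_exists => /forallP nP; left => j ij.
by have := nP j; rewrite ij.
Qed.

(* Descartes' rule of signs: with fewer than four sign changes, some cubic with
   roots at the places where the sign changes contradicts orthogonality. *)
Lemma sign_chain_pos (d : V -> R) (i1 : V) :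
  (forall c0 c1 c2 c3,
     \sum_i d i * (c0 + c1 * t i + c2 * t i ^+ 2 + c3 * t i ^+ 3) = 0) ->
  0 < d i1 -> (forall i, (i < i1)%N -> d i = 0) ->
  exists i2 i3 i4 i5 : V,
    [/\ [/\ (i1 < i2)%N, (i2 < i3)%N, (i3 < i4)%N & (i4 < i5)%N],
        d i2 < 0, 0 < d i3, d i4 < 0 & 0 < d i5].
Proof.
move=> orth d1 d_lt.
have [np|[i2 l12 [d2 m2]]] := ex_next (fun i => d i < 0) i1.
  case: (@sum_ge0_neq0 d i1) => //.
    move=> i; case: (ltngtP i i1) => [/d_lt->//|/np|/val_inj -> ]; last exact: ltW.
    by rewrite -leNgt.
  by rewrite -[RHS](orth 1 0 0 0); apply: eq_bigr => i _; ring.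
have s2 i : (i < i2)%N -> 0 <= d i.
  move=> i2i; case: (ltngtP i i1) => [/d_lt->//|li|/val_inj -> ]; last exact: ltW.
  by have := m2 _ li i2i; rewrite -leNgt.
(* If no positive value follows i2, then d changes sign only there, and its product with the linear
   polynomial vanishing at t i2 is nowhere positive but negative at i1. The next two steps use the
   quadratic and the cubic in the same way. *)
have [np|[i3 l23 [d3 m3]]] := ex_next (fun i => 0 < d i) i2.
  case: (@sum_le0_neq0 (fun i => d i * (t i - t i2)) i1).
  - move=> i; case: (ltngtP i i2) => [li|li|/val_inj ->].
    + by rewrite mulr_ge0_le0 ?s2 // subr_le0 ltW ?t_lt.
    + have := np _ li; rewrite -leNgt => di.
      by rewrite mulr_le0_ge0 // subr_ge0 ltW ?t_lt.
    + by rewrite subrr mulr0.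
  - by rewrite pmulr_rlt0 // subr_lt0 t_lt.
  - by rewrite -[RHS](orth (- t i2) 1 0 0); apply: eq_bigr => i _; ring.
have s3 i : (i2 < i)%N -> (i < i3)%N -> d i <= 0.
  by move=> h1 h2; have := m3 _ h1 h2; rewrite -leNgt.
have l13 := ltn_trans l12 l23.
have [np|[i4 l34 [d4 m4]]] := ex_next (fun i => d i < 0) i3.
  case: (@sum_ge0_neq0 (fun i => d i * ((t i - t i2) * (t i - t i3))) i1).
  - move=> i; case: (ltngtP i i2) => [li|li|/val_inj ->].
    + rewrite mulr_ge0 ?s2 // mulr_le0 // subr_le0 t_le //; first exact: ltnW.
      exact/ltnW/(ltn_trans li).
    + case: (ltngtP i i3) => [li3|li3|/val_inj ->].
      * rewrite mulr_le0 ?s3 // mulr_ge0_le0 // ?subr_le0 ?subr_ge0 t_le //; exact: ltnW.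
      * have := np _ li3; rewrite -leNgt => di.
        rewrite !mulr_ge0 // subr_ge0 t_le //; exact: ltnW.
      * by rewrite subrr !mulr0.
    + by rewrite subrr mul0r mulr0.
  - by rewrite mulr_gt0 // nmulr_rgt0 subr_lt0 t_lt.
  - rewrite -[RHS](orth (t i2 * t i3) (- t i2 - t i3) 1 0).
    by apply: eq_bigr => i _; ring.
have s4 i : (i3 < i)%N -> (i < i4)%N -> 0 <= d i.
  by move=> h1 h2; have := m4 _ h1 h2; rewrite -leNgt.
have l14 := ltn_trans l13 l34.
have l24 := ltn_trans l23 l34.
have [np|[i5 l45 [d5 _]]] := ex_next (fun i => 0 < d i) i4; last first.
  by exists i2, i3, i4, i5.
case: (@sum_le0_neq0 (fun i => d i * ((t i - t i2) * (t i - t i3) * (t i - t i4))) i1).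
- move=> i; case: (ltngtP i i2) => [li|li|/val_inj ->].
  + rewrite mulr_ge0_le0 ?s2 // mulr_ge0_le0 ?mulr_le0 // subr_le0 t_le //; lia.
  + case: (ltngtP i i3) => [li3|li3|/val_inj ->].
    * rewrite mulr_le0_ge0 ?s3 // mulr_le0 // ?mulr_ge0_le0 // ?subr_le0 ?subr_ge0 t_le //; lia.
    * case: (ltngtP i i4) => [li4|li4|/val_inj ->].
      -- rewrite mulr_ge0_le0 ?s4 // mulr_ge0_le0 // ?mulr_ge0 // ?subr_le0 ?subr_ge0 t_le //; lia.
      -- have := np _ li4; rewrite -leNgt => di.
         rewrite mulr_le0_ge0 // !mulr_ge0 // subr_ge0 t_le //; lia.
      -- by rewrite subrr !mulr0.
    * by rewrite subrr mulr0 mul0r mulr0.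
  + by rewrite subrr !mul0r mulr0.
- by rewrite pmulr_rlt0 // pmulr_rlt0 ?subr_lt0 ?t_lt // nmulr_rgt0 subr_lt0 t_lt.
- rewrite -[RHS](orth (- (t i2 * t i3 * t i4)) (t i2 * t i3 + t i2 * t i4 + t i3 * t i4)
                     (- t i2 - t i3 - t i4) 1).
  by apply: eq_bigr => i _; ring.
Qed.

Definition crossing S A : Prop := exists a b c d e : V,
  [/\ [/\ (a < b)%N, (b < c)%N, (c < d)%N & (d < e)%N],
      [/\ a \in S, c \in S & e \in S] & b \in A /\ d \in A].

(** The difference of the weights is orthogonal to all cubics, so it has five alternating signs;
    positive values occur only in S, negative ones only in A. *)
Lemma baryN_crossing S A x lam mu (i1 : V) :
  bary S x lam -> bary A x mu ->
  0 < lam i1 - mu i1 -> (forall i, (i < i1)%N -> lam i - mu i = 0) ->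
  crossing S A.
Proof.
move=> bS bA d1 d_lt.
have orth c0 c1 c2 c3 :
   \sum_i (lam i - mu i) * (c0 + c1 * t i + c2 * t i ^+ 2 + c3 * t i ^+ 3) = 0.
  under eq_bigr do rewrite mulrBl.
  by rewrite sumrB -(aff_bary _ _ _ _ bS) -(aff_bary _ _ _ _ bA) subrr.
case: bS bA => lam0 lamS _ _ [mu0 muA _ _].
have posS i : 0 < lam i - mu i -> i \in S.
  by apply: contraTT => /lamS ->; rewrite sub0r oppr_gt0 -leNgt.
have negA i : lam i - mu i < 0 -> i \in A.
  by apply: contraTT => /muA ->; rewrite subr0 -leNgt.
have [i2 [i3 [i4 [i5 [ls s2 s3 s4 s5]]]]] := sign_chain_pos orth d1 d_lt.
exists i1, i2, i3, i4, i5; split; [exact: ls| |].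
  by split; apply: posS.
by split; apply: negA.
Qed.

Lemma bary_eq_or_crossing S A x lam mu :
  bary S x lam -> bary A x mu ->
  [\/ forall i, lam i = mu i, crossing S A | crossing A S].
Proof.
move=> bS bA.
have [/existsP ex|] := boolP [exists i : V, lam i - mu i != 0]; last first.
  rewrite negb_exists => /forallP e; constructor 1 => i.
  by apply/eqP; rewrite -subr_eq0; have := e i; rewrite negbK.
have [i1 d1 min1] := ex_min_ord ex.
have d_lt i : (i < i1)%N -> lam i - mu i = 0.
  by move=> li; apply/eqP; apply: contraTT li => /min1; rewrite -leqNgt.
case: (ltgtP 0 (lam i1 - mu i1)) => [pos|neg|e].
- by constructor 2; apply: baryN_crossing bS bA pos d_lt.
- constructor 3; apply: (baryN_crossing bA bS (i1 := i1)); first by rewrite -opprB oppr_gt0.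
  by move=> i /d_lt e; rewrite -opprB e oppr0.
- by rewrite -e eqxx in d1.
Qed.

Lemma bary_sub S A x lam : S \subset A -> bary S x lam -> bary A x lam.
Proof.
move=> /subsetP sub [l0 lS l1 ex]; split=> // i iA; apply: lS.
by apply: contra iA; apply: sub.
Qed.

Lemma in_conv_sub S A x : S \subset A -> in_conv t S x -> in_conv t A x.
Proof. by move=> sub [lam b]; exists lam; apply: bary_sub b. Qed.

Lemma crossing_card S : crossing S S -> (4 < #|S|)%N.
Proof.
case=> a [b [c [d [e [[ab bc cd de] [aS cS eS] [bS dS]]]]]].
rewrite cardE; apply: (@uniq_leq_size _ [:: a; b; c; d; e]).
  by rewrite /= !inE -!val_eqE /=; lia.
by move=> i; rewrite mem_enum !inE => /or4P[||| /orP[]] /eqP ->.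
Qed.

(** Different weights would make S cross itself, which takes five vertices. *)
Lemma bary_uniq S x lam mu : (#|S| <= 4)%N ->
  bary S x lam -> bary S x mu -> forall i, lam i = mu i.
Proof.
move=> S4 b1 b2; case: (bary_eq_or_crossing b1 b2) => // /crossing_card; lia.
Qed.

(** * Explicit points and circuits *)

Definition pcomb (s : seq (V * R)) : 'rV[R]_3 := \sum_i comb s i *: moment_pt t i.

Lemma bary_pcomb S s :
  all (fun p => (0 <= p.2) && (p.1 \in S)) s -> \sum_(p <- s) p.2 = 1 ->
  bary S (pcomb s) (comb s).
Proof.
move=> s_ok s1; apply: bary_comb => // k k3.
by rewrite /pcomb px_sum // (sum_comb s (fun i => t i ^+ k.+1)).
Qed.

Lemma aff_pcomb c0 c1 c2 c3 s : \sum_(p <- s) p.2 = 1 ->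
  aff c0 c1 c2 c3 (pcomb s) =
  \sum_(p <- s) p.2 * (c0 + c1 * t p.1 + c2 * t p.1 ^+ 2 + c3 * t p.1 ^+ 3).
Proof.
move=> s1; rewrite /aff /pcomb !px_sum //.
rewrite !(sum_comb s (fun i => t i ^+ _)) -{1}[c0]mulr1 -s1 !mulr_sumr.
by rewrite -!big_split; apply: eq_bigr => i _ /=; ring.
Qed.

Lemma comb_gt0 s p : all (fun p => 0 <= p.2) s -> p \in s -> 0 < p.2 -> 0 < comb s p.1.
Proof.
move=> /allP s0 ps p0; rewrite /comb (big_rem p ps) /= eqxx ltr_pwDl //.
rewrite big_seq; apply: sumr_ge0 => q /mem_rem qs.
by case: ifP => // _; apply: s0.
Qed.

(** The Vandermonde determinant of p, q, r, s. *)
Definition vander4 (p q r s : R) : R :=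
  (q - p) * (r - p) * (s - p) * (r - q) * (s - q) * (s - r).

Lemma vander4_gt0 p q r s : p < q -> q < r -> r < s -> 0 < vander4 p q r s.
Proof.
move=> pq qr rs; have pr := lt_trans pq qr; have qs := lt_trans qr rs.
by rewrite /vander4 !mulr_gt0 // subr_gt0 // (lt_trans pq).
Qed.

(* The coefficients are the maximal minors of the 4 x 5 Vandermonde matrix. *)
Lemma circuit (a b c d e : V) :
  (a < b)%N -> (b < c)%N -> (c < d)%N -> (d < e)%N ->
  exists x lam mu, bary [set a; c; e] x lam /\ bary [set b; d] x mu.
Proof.
move=> /t_lt ab /t_lt bc /t_lt cd /t_lt de.
have ac := lt_trans ab bc; have ad := lt_trans ac cd; have ce := lt_trans cd de.
have bd := lt_trans bc cd; have be := lt_trans bd de.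
have wa := vander4_gt0 bc cd de; have wb := vander4_gt0 ac cd de.
have wc := vander4_gt0 ab bd de; have wd := vander4_gt0 ab bc ce.
have we := vander4_gt0 ab bc cd.
set A := vander4 _ _ _ _ in wa; set B := vander4 _ _ _ _ in wb.
set C := vander4 _ _ _ _ in wc; set D := vander4 _ _ _ _ in wd.
set E := vander4 _ _ _ _ in we.
have M0 : 0 < B + D by rewrite addr_gt0.
have M0' : B + D != 0 by rewrite gt_eqF.
(* The minors of either side have the same sum, by which both combinations are normalised. *)
have eM : A + C + E = B + D by rewrite /A /B /C /D /E /vander4; ring.
have w0 u : 0 < u -> 0 <= u / (B + D) by move=> u0; rewrite divr_ge0 ?ltW.
exists (pcomb [:: (b, B / (B + D)); (d, D / (B + D))]).
exists (comb [:: (a, A / (B + D)); (c, C / (B + D)); (e, E / (B + D))]).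
exists (comb [:: (b, B / (B + D)); (d, D / (B + D))]); split; last first.
  apply: bary_pcomb; first by rewrite /= !inE !eqxx !w0 ?orbT.
  by rewrite !big_cons big_nil /= addr0 -mulrDl divff.
apply: bary_comb; first by rewrite /= !inE !eqxx !w0 ?orbT.
  by rewrite !big_cons big_nil /= addr0 -!mulrDl addrA eM divff.
move=> k k3; rewrite /pcomb px_sum // (sum_comb _ (fun i => t i ^+ k.+1)).
rewrite !big_cons !big_nil /=.
suff : A * t a ^+ k.+1 + C * t c ^+ k.+1 + E * t e ^+ k.+1 = B * t b ^+ k.+1 + D * t d ^+ k.+1.
  move=> h; rewrite !addr0 ![_ / _ * _]mulrAC -!mulrDl -h addrA //.
rewrite /A /B /C /D /E /vander4.
by case: k k3 => [|[|[|//]]] _; ring.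
Qed.

(* On the curve, q2 and q3 are the polynomials (X - t_a)(X - t_b) and
   (X - t_a)(X - t_b)(X - t_c); they are extended affinely to space. *)
Definition q2 x (a b : V) : R := aff (t a * t b) (- (t a + t b)) 1 0 x.

Definition q3 x (a b c : V) : R :=
  aff (- (t a * t b * t c)) (t a * t b + t a * t c + t b * t c)
      (- (t a + t b + t c)) 1 x.

Lemma q2_bary S x lam a b : bary S x lam ->
  q2 x a b = \sum_i lam i * ((t i - t a) * (t i - t b)).
Proof.
by move=> bS; rewrite /q2 (aff_bary _ _ _ _ bS); apply: eq_bigr => i _; ring.
Qed.

Lemma q3_bary S x lam a b c : bary S x lam ->
  q3 x a b c = \sum_i lam i * ((t i - t a) * (t i - t b) * (t i - t c)).
Proof.
by move=> bS; rewrite /q3 (aff_bary _ _ _ _ bS); apply: eq_bigr => i _; ring.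
Qed.

(** * Facet inequalities of a simplex *)

Lemma q3_conv_ge0 S x a b c (s : R) : in_conv t S x ->
  (forall i, i \in S -> 0 <= s * ((t i - t a) * (t i - t b) * (t i - t c))) ->
  0 <= s * q3 x a b c.
Proof.
case=> lam bS h; rewrite (q3_bary _ _ _ bS) mulr_sumr; apply: sumr_ge0 => i _.
case: bS => l0 lS _ _; have [/h hi|/lS ->] := boolP (i \in S).
  by rewrite mulrCA mulr_ge0.
by rewrite mul0r mulr0.
Qed.

Lemma mem_simplex x (a b c d : V) :
  (a < b)%N -> (b < c)%N -> (c < d)%N ->
  0 <= q3 x a b c -> q3 x a b d <= 0 -> 0 <= q3 x a c d -> q3 x b c d <= 0 ->
  in_conv t [set a; b; c; d] x.
Proof.
move=> /t_lt ab /t_lt bc /t_lt cd h1 h2 h3 h4.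
have ac := lt_trans ab bc; have ad := lt_trans ac cd; have bd := lt_trans bc cd.
have ab' : t b - t a != 0 by rewrite subr_eq0 gt_eqF.
have ac' : t c - t a != 0 by rewrite subr_eq0 gt_eqF.
have ad' : t d - t a != 0 by rewrite subr_eq0 gt_eqF.
have bc' : t c - t b != 0 by rewrite subr_eq0 gt_eqF.
have bd' : t d - t b != 0 by rewrite subr_eq0 gt_eqF.
have cd' : t d - t c != 0 by rewrite subr_eq0 gt_eqF.
(* Each weight is the [q3] of the opposite facet divided by its value at the vertex, with signs
   arranged to make the denominators positive. *)
pose wa := - q3 x b c d / ((t b - t a) * (t c - t a) * (t d - t a)).
pose wb := q3 x a c d / ((t b - t a) * (t c - t b) * (t d - t b)).
pose wc := - q3 x a b d / ((t c - t a) * (t c - t b) * (t d - t c)).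
pose wd := q3 x a b c / ((t d - t a) * (t d - t b) * (t d - t c)).
exists (comb [:: (a, wa); (b, wb); (c, wc); (d, wd)]).
apply: bary_comb.
- rewrite /= !inE !eqxx !orbT !andbT /=.
  by apply/and4P; split; rewrite /wa /wb /wc /wd divr_ge0 ?oppr_ge0 // !mulr_ge0 // subr_ge0 ltW.
- rewrite !big_cons big_nil /= /wa /wb /wc /wd /q3 /aff.
  by field; rewrite ab' ac' ad' bc' bd' cd'.
- move=> k k3; rewrite !big_cons big_nil /= /wa /wb /wc /wd /q3 /aff.
  by case: k k3 => [|[|[|//]]] _; field; rewrite ab' ac' ad' bc' bd' cd'.
Qed.

Lemma sub_lt0 i j : (i < j)%N -> t i - t j < 0.
Proof. by move=> /t_lt; rewrite subr_lt0. Qed.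

Lemma sub_gt0 i j : (i < j)%N -> 0 < t j - t i.
Proof. by move=> /t_lt; rewrite subr_gt0. Qed.

(** By [mem_simplex], a point outside violates one of the four facet inequalities, and that facet
    separates. *)
Lemma separation S y : #|S| = 4 -> ~ in_conv t S y ->
  exists s a b c, (forall x, in_conv t S x -> 0 <= s * q3 x a b c) /\ s * q3 y a b c < 0.
Proof.
move=> /sort_set4[a [b [c [d [ab bc cd ->]]]]] yS.
have ac := ltn_trans ab bc; have ad := ltn_trans ac cd; have bd := ltn_trans bc cd.
have [h1|h1] := ltP (q3 y a b c) 0.
  exists 1, a, b, c; split=> [x xS|]; last by rewrite mul1r.
  apply: q3_conv_ge0 xS _ => i; rewrite !inE mul1r -!orbA.
  by case/or4P=> /eqP ->; rewrite ?subrr ?mulr0 ?mul0r // ltW // !mulr_gt0 // sub_gt0.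
have [h2|h2] := ltP 0 (q3 y a b d).
  exists (-1), a, b, d; split=> [x xS|]; last by rewrite mulN1r oppr_lt0.
  apply: q3_conv_ge0 xS _ => i; rewrite !inE mulN1r oppr_ge0 -!orbA.
  case/or4P=> /eqP ->; rewrite ?subrr ?mulr0 ?mul0r // ltW //.
  by rewrite pmulr_rlt0 ?mulr_gt0 // ?sub_gt0 // sub_lt0.
have [h3|h3] := ltP (q3 y a c d) 0.
  exists 1, a, c, d; split=> [x xS|]; last by rewrite mul1r.
  apply: q3_conv_ge0 xS _ => i; rewrite !inE mul1r -!orbA.
  case/or4P=> /eqP ->; rewrite ?subrr ?mulr0 ?mul0r // ltW //.
  by rewrite -mulrA pmulr_rgt0 ?sub_gt0 // nmulr_rgt0 ?sub_lt0.
have [h4|h4] := ltP 0 (q3 y b c d).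
  exists (-1), b, c, d; split=> [x xS|]; last by rewrite mulN1r oppr_lt0.
  apply: q3_conv_ge0 xS _ => i; rewrite !inE mulN1r oppr_ge0 -!orbA.
  case/or4P=> /eqP ->; rewrite ?subrr ?mulr0 ?mul0r // ltW //.
  by rewrite pmulr_rlt0 ?sub_lt0 // nmulr_rgt0 ?sub_lt0.
by case: yS; apply: mem_simplex.
Qed.

(** * Faces, crossings and cofacets in a triangulation *)

Section FromTriangulation.
Variable T : {set {set V}}.
Hypothesis Ttri : triangulation t T.

Lemma tri_card S : S \in T -> #|S| = 4.
Proof. by case: Ttri => h _ _; apply: h. Qed.

(** The common face of S and S' gives x weights supported in both; uniqueness of weights in S
    identifies them with mu. *)
Lemma tri_face S S' A x mu : S \in T -> S' \in T -> A \subset S -> bary A x mu ->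
  in_conv t S' x -> forall i, 0 < mu i -> i \in S'.
Proof.
move=> ST S'T AS bA xS' i; have [_ _ /(_ _ _ ST S'T)[B]] := Ttri.
rewrite subsetI => /andP[BS BS'] hB.
have [nu bB] : in_conv t B x by apply/hB; split=> //; exists mu; apply: bary_sub bA.
have S4 : (#|S| <= 4)%N by rewrite (tri_card ST).
rewrite (bary_uniq S4 (bary_sub AS bA) (bary_sub BS bB)) => ni.
apply: (subsetP BS'); apply: contraTT ni; case: bB => _ h _ _ /h ->.
by rewrite ltxx.
Qed.

(** The point of the circuit lies in both simplices, so by [tri_face] its weights on ace live on S'.
    There they must equal its weights on bd, whose support is disjoint. *)
Lemma tri_noncrossing S S' : S \in T -> S' \in T -> ~ crossing S S'.
Proof.
move=> ST S'T [a [b [c [d [e [[ab bc cd de] [aS cS eS] [bS' dS']]]]]]].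
have [x [lam [mu [b1 b2]]]] := circuit ab bc cd de.
have sub : [set b; d] \subset S' by apply/subsetP => i; rewrite !inE => /orP[]/eqP->.
have sub' : [set a; c; e] \subset S.
  by apply/subsetP => i; rewrite !inE -orbA => /or3P[]/eqP->.
have xS' : in_conv t S' x by exists mu; apply: bary_sub b2.
have xS : in_conv t S x by exists lam; apply: bary_sub b1.
have h i : 0 < lam i -> i \in S' by apply: tri_face ST S'T sub' b1 xS' i.
have lamS' : bary S' x lam.
  case: b1 => l0 _ l1 ex; split=> // i; apply: contraNeq => li.
  by apply: h; rewrite lt_def li l0.
have S4 : (#|S'| <= 4)%N by rewrite (tri_card S'T).
have eq_lm := bary_uniq S4 lamS' (bary_sub sub b2).
case: b1 b2 => l0 lS l1 _ [_ mS _ _].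
have z i : lam i = 0.
  have [ib|] := boolP (i \in [set b; d]); last by rewrite eq_lm => /mS.
  apply: lS; move: ib; rewrite !inE => /orP[]/eqP->; rewrite -!val_eqE /=; lia.
by move: l1 => /eqP; rewrite big1 // eq_sym oner_eq0.
Qed.

(** Compares the weights of the midpoint of bd with those in a simplex covering it; a pair cannot
    contain the triangle of a circuit, which rules out the third case. *)
Lemma tri_edge_or_crossed (b d : V) : (b < d)%N ->
  (exists2 S, S \in T & b \in S /\ d \in S) \/
  exists S, S \in T /\ exists a c e : V,
    [/\ [/\ (a < b)%N, (b < c)%N, (c < d)%N & (d < e)%N], a \in S, c \in S & e \in S].
Proof.
move=> bd; have h0 : 0 <= 2^-1 :> R by rewrite invr_ge0 ler0n.
have bx : bary [set b; d] (pcomb [:: (b, 2^-1); (d, 2^-1)]) (comb [:: (b, 2^-1); (d, 2^-1)]).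
  apply: bary_pcomb; first by rewrite /= !inE !eqxx h0 orbT.
  by rewrite !big_cons big_nil /=; field.
have [_ cov _] := Ttri.
have [|S ST [mu bS]] := cov (pcomb [:: (b, 2^-1); (d, 2^-1)]).
  by eexists; apply: bary_sub bx; apply: subsetT.
have db : (d == b) = false by apply/eqP => e; rewrite e ltnn in bd.
case: (bary_eq_or_crossing bx bS).
- move=> e; left; exists S => //; case: bS => _ mS _ _.
  have n0 : 2^-1 != 0 :> R by rewrite invr_eq0 pnatr_eq0.
  split; apply: contraNT n0 => /mS; rewrite -e /comb !big_cons big_nil /= eqxx.
    by rewrite eq_sym db !addr0 => ->.
  by rewrite db addr0 add0r => ->.
- case=> [a' [b' [c' [d' [e' [[l1 l2 l3 l4] [+ + +] _]]]]]]; rewrite !inE -!val_eqE /=; lia.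
- case=> [a' [b' [c' [d' [e' [[l1 l2 l3 l4] [aS cS eS] [+ +]]]]]]].
  rewrite !inE -!val_eqE /= => hb hd; right; exists S; split=> //.
  by exists a', c', e'; split=> //; split; lia.
Qed.

(* Points slightly off the barycenter of abc, towards a vertex on a given side,
   lie in a simplex which contains the triangle abc and a vertex on that side. *)
Lemma tri_cofacet (s : R) (a b c v : V) S : S \in T ->
  (a < b)%N -> (b < c)%N -> a \in S -> b \in S -> c \in S ->
  0 < s * ((t v - t a) * (t v - t b) * (t v - t c)) ->
  exists S' w, [/\ S' \in T, [/\ a \in S', b \in S' & c \in S'], w \in S'
     & 0 < s * ((t w - t a) * (t w - t b) * (t w - t c))].
Proof.
move=> ST ab bc aS bS cS v0.
have ac := ltn_trans ab bc.
pose w3 : seq (V * R) := [:: (a, 3^-1); (b, 3^-1); (c, 3^-1)].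
have t0 : 0 < 3^-1 :> R by rewrite invr_gt0 ltr0n.
have w3b : bary [set a; b; c] (pcomb w3) (comb w3).
  apply: bary_pcomb; first by rewrite /= !inE !eqxx (ltW t0) !orbT.
  by rewrite /w3 !big_cons big_nil /=; field.
have sub : [set a; b; c] \subset S.
  by apply/subsetP => i; rewrite !inE -orbA => /or3P[]/eqP->.
pose we (e : R) : seq (V * R) :=
  [:: (a, (1 - e) / 3); (b, (1 - e) / 3); (c, (1 - e) / 3); (v, e)].
have sum_we e : \sum_(p <- we e) p.2 = 1.
  by rewrite /we !big_cons big_nil /=; field.
have sum_w3 : \sum_(p <- w3) p.2 = 1 by rewrite /w3 !big_cons big_nil /=; field.
have qe e a' b' c' : q3 (pcomb (we e)) a' b' c' = (1 - e) * q3 (pcomb w3) a' b' c' +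
    e * ((t v - t a') * (t v - t b') * (t v - t c')).
  rewrite /q3 !aff_pcomb // /we /w3 !big_cons !big_nil /=.
  by field.
apply: contrapT => nex.
(* Were there no such cofacet, every simplex would miss the moved points for small e. If it contains
   the barycenter, it contains a, b, c and has no vertex on the wanted side; otherwise a facet
   separating it from the barycenter still does so after a small move. *)
have [|d d0 hd] := @common_radius R _ (enum T) (fun S' e => ~ in_conv t S' (pcomb (we e))).
  move=> S'; rewrite mem_enum => S'T.
  have [in0|/(separation (tri_card S'T))] := pselect (in_conv t S' (pcomb w3)).
    have face := tri_face ST S'T sub w3b in0.
    have [aS' bS' cS'] : [/\ a \in S', b \in S' & c \in S'].
      split; apply: face; apply: (comb_gt0 (p := (_, 3^-1))) => //=.
      - by rewrite !(ltW t0).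
      - by rewrite mem_head.
      - by rewrite !(ltW t0).
      - by rewrite !inE eqxx orbT.
      - by rewrite !(ltW t0).
      - by rewrite !inE eqxx !orbT.
    exists 1 => // e /andP[e0 e1] hin.
    suff : 0 <= - s * q3 (pcomb (we e)) a b c.
      rewrite qe.
      have -> : q3 (pcomb w3) a b c = 0.
        by rewrite /q3 !aff_pcomb // /w3 !big_cons !big_nil /=; field.
      rewrite mulr0 add0r mulNr mulrCA oppr_ge0 leNgt.
      by rewrite mulr_gt0.
    apply: q3_conv_ge0 hin _ => w wS'; rewrite mulNr oppr_ge0 leNgt.
    by apply/negP => w0; apply: nex; exists S', w.
  case=> [s' [a' [b' [c' [pos neg]]]]].
  set Q := s' * q3 _ _ _ _ in neg.
  pose W := s' * ((t v - t a') * (t v - t b') * (t v - t c')).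
  have qe' e : s' * q3 (pcomb (we e)) a' b' c' = (1 - e) * Q + e * W.
    by rewrite qe /Q /W; ring.
  (* The bound on e under which (1 - e) Q + e |W| stays negative. *)
  exists (- Q / (`|W| - Q)); first by rewrite divr_gt0 ?oppr_gt0 // subr_gt0 (lt_le_trans neg).
  move=> e /andP[e0]; rewrite ltr_pdivlMr ?subr_gt0 ?(lt_le_trans neg) // => ed hin.
  have := pos _ hin; rewrite qe' leNgt => /negP; apply.
  have : e * W <= e * `|W| by rewrite ler_pM2l // ler_norm.
  by move: ed; rewrite mulrBr mulrBl mul1r; lra.
pose e := Num.min d 1 / 2.
have m0 : 0 < Num.min d 1 by rewrite lt_min d0 ltr01.
have e0 : 0 < e by rewrite divr_gt0.
have em : e < Num.min d 1 by rewrite /e; lra.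
move: (em); rewrite lt_min => /andP[ed e1].
have [_ cov _] := Ttri.
have [|S' S'T] := cov (pcomb (we e)).
  exists (comb (we e)); apply: bary_pcomb => //.
  by rewrite /= !inE !andbT (ltW e0) !divr_ge0 ?ler0n // subr_ge0 ltW.
by apply: hd; rewrite ?mem_enum // e0.
Qed.

End FromTriangulation.

(** * Sides of the plane through three vertices *)

Lemma cubic_gt0 (a b c v : V) : (a < b)%N -> (b < c)%N ->
  (0 < (t v - t a) * (t v - t b) * (t v - t c)) = (c < v)%N || (a < v < b)%N.
Proof.
move=> ab bc; have ac := ltn_trans ab bc.
case: (ltngtP v a) => [va|av|/val_inj->]; last by rewrite subrr !mul0r ltxx; lia.
  rewrite pmulr_rgt0 ?nmulr_rgt0 ?sub_lt0 //; last exact: ltn_trans ab.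
  rewrite ltNge (ltW (sub_lt0 (ltn_trans va ac))) /=; lia.
case: (ltngtP v b) => [vb|bv|/val_inj->]; last by rewrite subrr mulr0 mul0r ltxx; lia.
  by rewrite nmulr_rgt0 ?sub_lt0 ?(ltn_trans vb bc) ?orbT // pmulr_rlt0 ?sub_gt0 ?sub_lt0.
rewrite pmulr_rgt0; last by rewrite mulr_gt0 // sub_gt0.
rewrite /= orbF subr_gt0.
case: (ltngtP v c) => [vc|/t_lt->//|/val_inj->]; last by rewrite ltxx.
by rewrite ltNge ltW // t_lt.
Qed.

Lemma cubic_lt0 (a b c v : V) : (a < b)%N -> (b < c)%N ->
  (0 < -1 * ((t v - t a) * (t v - t b) * (t v - t c))) = (v < a)%N || (b < v < c)%N.
Proof.
move=> ab bc; have ac := ltn_trans ab bc; rewrite mulN1r oppr_gt0.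
case: (ltngtP v c) => [vc|cv|/val_inj->]; last by rewrite subrr mulr0 ltxx; lia.
  rewrite nmulr_llt0 ?sub_lt0 //.
  case: (ltngtP v a) => [va|av|/val_inj->]; last by rewrite subrr mul0r ltxx; lia.
    by rewrite nmulr_rgt0 ?sub_lt0 // (ltn_trans va).
  rewrite pmulr_rgt0; last exact: sub_gt0.
  rewrite /= andbT.
  case: (ltngtP v b) => [vb|/sub_gt0->//|/val_inj->]; last by rewrite subrr ltxx.
  by rewrite ltNge ltW ?sub_lt0.
have av := ltn_trans ac cv; have bv := ltn_trans bc cv.
rewrite ltNge ltW ?mulr_gt0 ?sub_gt0 //=; lia.
Qed.

Section Facets.
Variable T : {set {set V}}.
Hypothesis Ttri : triangulation t T.

Lemma tri_above (a b c v : V) S : S \in T ->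
  (a < b)%N -> (b < c)%N -> a \in S -> b \in S -> c \in S -> (c < v)%N || (a < v < b)%N ->
  exists S' w, [/\ S' \in T, [/\ a \in S', b \in S' & c \in S'], w \in S'
     & (c < w)%N || (a < w < b)%N].
Proof.
move=> ST ab bc aS bS cS; rewrite -cubic_gt0 // -[X in 0 < X]mul1r.
move=> /(tri_cofacet Ttri ST ab bc aS bS cS)[S' [w [S'T abc wS']]].
by rewrite mul1r cubic_gt0 // => h; exists S', w.
Qed.

Lemma tri_below (a b c v : V) S : S \in T ->
  (a < b)%N -> (b < c)%N -> a \in S -> b \in S -> c \in S -> (v < a)%N || (b < v < c)%N ->
  exists S' w, [/\ S' \in T, [/\ a \in S', b \in S' & c \in S'], w \in S'
     & (w < a)%N || (b < w < c)%N].
Proof.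
move=> ST ab bc aS bS cS; rewrite -cubic_lt0 //.
move=> /(tri_cofacet Ttri ST ab bc aS bS cS)[S' [w [S'T abc wS']]].
by rewrite cubic_lt0 // => h; exists S', w.
Qed.

End Facets.

(* The vertical line through x meets the triangle abc weakly below x. *)
Definition above x (a b c : V) : Prop :=
  [/\ 0 <= q2 x a b, q2 x a c <= 0, 0 <= q2 x b c & 0 <= q3 x a b c].

(** Seen vertically, the simplex is a quadrilateral inscribed in a parabola; ac separates its lower
    facets abc and acd, and bd its upper facets abd and bcd. The sign of [q2 x b d] selects the
    upper facet over x, and x is in the simplex unless it is strictly above that facet. *)
Lemma above_step x (a b c d : V) : (a < b)%N -> (b < c)%N -> (c < d)%N ->
  above x a b c \/ above x a c d ->
  [\/ in_conv t [set a; b; c; d] x,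
      above x a b d /\ 0 < q3 x a b d | above x b c d /\ 0 < q3 x b c d].
Proof.
move=> ab bc cd; have := @mem_simplex x _ _ _ _ ab bc cd.
move: (sub_gt0 ab) (sub_gt0 bc) (sub_gt0 cd); rewrite /above.
move=> ab' bc' cd' mem hyp.
have ac' : 0 < t c - t a by lra.
have bd' : 0 < t d - t b by lra.
have da' : 0 < t d - t a by lra.
(* The planes of two facets agree over their common edge, so their [q3] differ by a multiple of the
   [q2] of that edge; [e3] to [e6] are linear relations between the [q2] of different chords. *)
have e1 : q3 x a c d = q3 x a b c - (t d - t b) * q2 x a c by rewrite /q3 /q2 /aff; ring.
have e2 : q3 x b c d = q3 x a b d - (t c - t a) * q2 x b d by rewrite /q3 /q2 /aff; ring.
have e3 : (t b - t a) * q2 x c d = (t d - t a) * q2 x b c - (t d - t b) * q2 x a c.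
  by rewrite /q2 /aff; ring.
have e4 : (t c - t b) * q2 x a d = (t d - t b) * q2 x a c - (t d - t c) * q2 x a b.
  by rewrite /q2 /aff; ring.
have e5 : (t d - t c) * q2 x a b = (t d - t b) * q2 x a c - (t c - t b) * q2 x a d.
  by rewrite /q2 /aff; ring.
have e6 : (t d - t a) * q2 x b c = (t b - t a) * q2 x c d + (t d - t b) * q2 x a c.
  by rewrite /q2 /aff; ring.
have [hab hbc hcd had] : [/\ 0 <= q2 x a b, 0 <= q2 x b c, 0 <= q2 x c d & q2 x a d <= 0].
  case: hyp => -[h1 h2 h3 h4]; split => //.
  - by rewrite -(pmulr_rge0 _ ab') e3 subr_ge0 (le_trans (y := 0)) ?mulr_ge0 ?pmulr_rle0 // ltW.
  - by rewrite -(pmulr_rle0 _ bc') e4 subr_le0 (le_trans (y := 0)) ?mulr_ge0 ?pmulr_rle0 // ltW.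
  - by rewrite -(pmulr_rge0 _ cd') e5 subr_ge0 (le_trans (y := 0)) ?mulr_ge0 ?pmulr_rle0 // ltW.
  - by rewrite -(pmulr_rge0 _ da') e6 addr_ge0 // mulr_ge0 // ltW.
have [habc hacd] : 0 <= q3 x a b c /\ 0 <= q3 x a c d.
  case: hyp => -[h1 h2 h3 h4]; split => //.
  - by rewrite e1 subr_ge0 (le_trans (y := 0)) // pmulr_rle0.
  - by move: h4; rewrite e1 subr_ge0 => /(le_trans _); apply; rewrite mulr_ge0 // ltW.
have [hbd|hbd] := leP 0 (q2 x b d).
  have [p|p] := ltP 0 (q3 x a b d); first by constructor 2; split=> //; split=> //; apply: ltW.
  constructor 1; apply: mem => //; rewrite e2 subr_le0 (le_trans p) //.
  by rewrite mulr_ge0 // ltW.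
have [p|p] := ltP 0 (q3 x b c d).
  by constructor 3; split=> //; split=> //; apply: ltW.
constructor 1; apply: mem => //.
move: p; rewrite e2 subr_le0 => /le_trans; apply.
by rewrite pmulr_rle0 // ltW.
Qed.

(** Keeps the walk going: a triangle strictly below a point of the polytope is not an upper
    facet. *)
Lemma q3_gt0_vertex S x a b c : in_conv t S x -> 0 < q3 x a b c ->
  exists v, 0 < (t v - t a) * (t v - t b) * (t v - t c).
Proof.
move=> xS; rewrite ltNge => /negP h; apply/existsP; apply: contraPT xS.
rewrite negb_exists => /forallP neg xS; apply: h.
rewrite -oppr_ge0 -mulN1r; apply: q3_conv_ge0 xS _ => i _.
by rewrite mulN1r oppr_ge0 leNgt.
Qed.

Lemma above_bottom x : (0 < n)%N -> in_conv t [set: V] x ->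
  exists i j : V, [/\ (0 < i)%N, j = i.+1 :> nat & above x ord0 i j].
Proof.
move=> n0 [lam bx]; have l0 : forall i, 0 <= lam i by case: bx.
have q2_ge0 i j : (forall k, 0 <= (t k - t i) * (t k - t j)) -> 0 <= q2 x i j.
  by move=> h; rewrite (q2_bary _ _ bx); apply: sumr_ge0 => k _; rewrite mulr_ge0.
have t0 k : 0 <= t k - t ord0 by rewrite subr_ge0 t_le.
have consec (i j : V) : j = i.+1 :> nat -> forall k, 0 <= (t k - t i) * (t k - t j).
  move=> ij k; have [ki|ik] := leqP k i.
    by rewrite mulr_le0 // subr_le0 t_le // ij leqW.
  by rewrite mulr_ge0 // subr_ge0 t_le ?ij // ltnW.
(* Vertically the lower facets form a fan of triangles at 0; the largest i with x on the nonnegative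
   side of the chord 0i picks the triangle under x. *)
have ex' : exists i : V, [&& (0 < i)%N, (i <= n)%N & 0 <= q2 x ord0 i].
  exists (inord 1); rewrite inordK //= n0 /=; apply: q2_ge0; apply: consec.
  by rewrite inordK.
have [i /and3P[i0 lin qi] imax] := ex_max_ord ex'.
pose j : V := inord i.+1; have ej : j = i.+1 :> nat by rewrite inordK.
exists i, j; split=> //.
split=> //; first 1 last.
- by apply: q2_ge0; apply: consec.
- rewrite (q3_bary _ _ _ bx); apply: sumr_ge0 => k _.
  by rewrite mulr_ge0 // -mulrA mulr_ge0 // consec.
have [jn|jn] := leqP j n.
  rewrite leNgt; apply/negP => qj; have := imax j; rewrite jn (ltW qj) ej /=; lia.
rewrite (q2_bary _ _ bx) -oppr_ge0 -sumrN; apply: sumr_ge0 => k _.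
rewrite oppr_ge0 mulr_ge0_le0 // mulr_ge0_le0 // subr_le0 t_le //.
by have := ltn_ord k; rewrite ltnS => /leq_trans; apply.
Qed.

(** * The simplices of a persistent graph triangulate the polytope *)

Section Cover.
Variable E : {set {set V}}.
Hypothesis Epers : persistent n E.

(* The vertical line through x is followed upwards from triangle to triangle;
   each step increases (a, c, -b) lexicographically. *)
Lemma walk_up x (a b c v : V) : in_conv t [set: V] x ->
  unpierced E a b c -> above x a b c -> (c < v)%N || (a < v < b)%N ->
  exists2 S, S \in Xi n E & in_conv t S x.
Proof.
move=> xP; have [N ltN] : exists N, forall i, (i < N)%N by exists n.+2 => i; exact: ltn_ord.
(* The lexicographic order written as one number in base N, which exceeds every index; it decreases
   as a or c grows or b drops. *)
have [m] := ubnP ((N - a) * (N * N) + (N - c) * N + b)%N.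
elim: m => // m IHm in a b c v * => rank unp up hv.
have next (a' b' c' : V) : unpierced E a' b' c' -> above x a' b' c' ->
    0 < q3 x a' b' c' ->
    (a < a')%N || (a == a') && ((c < c')%N || (c == c') && (b' < b)%N) ->
    exists2 S, S \in Xi n E & in_conv t S x.
  move=> unp' up' pos lex; have [[ab' bc'] _ _ _ _] := unp'.
  have [w] := q3_gt0_vertex xP pos; rewrite cubic_gt0 // => hw.
  apply: (IHm _ _ _ _ _ unp' up' hw).
  have := (ltN a, ltN b, ltN c, ltN a', ltN b', ltN c').
  case: unp => -[ab bc] _ _ _ _.
  move=> [[[[[la lb] lc] la'] lb'] lc']; rewrite ltnS in rank; apply: leq_trans rank.
  have hc M (k l : V) : (k < l)%N -> ((N - l) * M + M <= (N - k) * M)%N.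
    by move=> kl; have := ltN l; rewrite -mulSnr leq_mul2r => ll; apply/orP; right; lia.
  case/orP: lex => [aa|/andP[/eqP <-]].
    have := hc (N * N)%N _ _ aa.
    have : ((N - c') * N + N <= N * N)%N.
      by rewrite -mulSnr leq_mul2r; apply/orP; right; lia.
    by lia.
  by case/orP=> [/(hc N)|/andP[/eqP <-]]; lia.
have [[ab bc] _ _ _ _] := unp.
(* Above abcz the walk continues at abz, where c grows, or at bcz, where a grows; above azbc it
   continues at azc, where b drops, or at zbc, where a grows. *)
case: (unpierced_lift Epers unp hv) => -[z hz zX].
  have [aS bS cS zS] : [/\ a \in [set a; b; c; z], b \in [set a; b; c; z],
      c \in [set a; b; c; z] & z \in [set a; b; c; z]] by rewrite !inE !eqxx !orbT.
  have [] := above_step ab bc hz (or_introl up); first by exists [set a; b; c; z].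
    case=> up' pos; apply: next up' pos _; last by rewrite eqxx hz orbT.
    by apply: (unpierced_face Epers zX) => //; apply: ltn_trans hz.
  case=> up' pos; apply: next up' pos _; last by rewrite ab.
  exact: (unpierced_face Epers zX).
case/andP: hz => az zb.
have [aS bS cS zS] : [/\ a \in [set a; z; b; c], b \in [set a; z; b; c],
    c \in [set a; z; b; c] & z \in [set a; z; b; c]] by rewrite !inE !eqxx !orbT.
have [] := above_step az zb bc (or_intror up); first by exists [set a; z; b; c].
  case=> up' pos; apply: next up' pos _; last by rewrite !eqxx zb !orbT.
  by apply: (unpierced_face Epers zX) => //; apply: ltn_trans bc.
case=> up' pos; apply: next up' pos _; last by rewrite az.
exact: (unpierced_face Epers zX).
Qed.

Lemma Xi_triangulation : (1 < n)%N -> triangulation t (Xi n E).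
Proof.
move=> n2; split.
- move=> S /(XiP (pers_graph Epers))[a [b [c [d [[ab bc cd] -> _ _ _]]]]].
  exact: cards4_lt.
- move=> x xP; have [|i [j [i0 ij up]]] := above_bottom _ xP; first exact: ltnW.
  have lj := ltn_ord j; have unp := unpierced_bottom Epers i0 ij.
  (* The starting triangle is no upper facet: n+1 lies beyond j, or else j = n+1 and vertex 1 lies
     between 0 and i = n, because n is at least 2. *)
  have [in1|in1] := ltnP j n.+1.
    by apply: (walk_up (v := ord_max) xP unp up); rewrite in1.
  have e1 : (inord 1 : V) = 1%N :> nat by rewrite inordK.
  by apply: (walk_up (v := inord 1) xP unp up); rewrite e1 /=; lia.
- move=> S1 S2 S1X S2X; exists (S1 :&: S2) => // x; split; last first.
    by move=> xA; split; apply: in_conv_sub xA; rewrite ?subsetIl ?subsetIr.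
  have ncr S S' : S \in Xi n E -> S' \in Xi n E -> ~ crossing S S'.
    move=> SX S'X [a [b [c [d [e [[ab bc cd de] [aS cS eS] [bS dS]]]]]]].
    have bd := ltn_trans bc cd.
    exact: (Xi_noncrossing Epers SX (Xi_edges Epers S'X bS dS bd) bd aS cS eS).
  case=> -[lam b1] [mu b2]; have [e|/ncr|/ncr] := bary_eq_or_crossing b1 b2; try tauto.
  case: b1 b2 => l0 lS l1 ex [_ mS _ _]; exists lam; split=> // i.
  by rewrite inE negb_and => /orP[/lS//|/mS]; rewrite -e.
Qed.

End Cover.

(** * The graph of a triangulation *)

Section Recover.
Variable T : {set {set V}}.
Hypothesis Ttri : triangulation t T.
Local Notation H := (hat_adj n (Gamma n T)).
Implicit Types a b c d v w z : V.

(** The hat graph is the full edge graph of T: a triangle piercing a pair that contains 0 or n+1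
    would need a vertex outside the range. *)
Lemma tri_hat a b : (a < b)%N -> H a b <-> exists2 S, S \in T & a \in S /\ b \in S.
Proof.
move=> ab; have lb := ltn_ord b; split; last first.
  case=> S ST [aS bS]; case: (hat_cases ab) => [?|?|[a0 bn]].
  - exact: hat0.
  - exact: hat_last.
  rewrite hat_inner // inE cards2 -val_eqE /= (ltn_eqF ab) /=; apply/andP; split.
    by apply/subsetP => i; rewrite !inE /inner => /orP[]/eqP->; lia.
  apply/existsP; exists S; rewrite ST /=.
  by apply/subsetP => i; rewrite !inE => /orP[]/eqP->.
case: (hat_cases ab) => [a0 _|bn _|[a0 bn]].
- have [//|[S [_ [a' [c [e [[l1 _ _ _] _ _ _]]]]]]] := tri_edge_or_crossed Ttri ab; lia.
- have [//|[S [_ [a' [c [e [[_ _ _ l4] _ _ _]]]]]]] := tri_edge_or_crossed Ttri ab.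
  by have := ltn_ord e; lia.
- rewrite hat_inner // inE => /and3P[_ _ /existsP[S /andP[ST /subsetP sub]]].
  by exists S => //; split; apply: sub; rewrite !inE eqxx ?orbT.
Qed.

Lemma tri_no_cross S a b c (x y : V) : S \in T -> a \in S -> b \in S -> c \in S ->
  (a < x)%N -> (x < b)%N -> (b < y)%N -> (y < c)%N -> H x y -> False.
Proof.
move=> ST aS bS cS ax xb by_ yc /(tri_hat (ltn_trans xb by_))[S' S'T [xS yS]].
by apply: (tri_noncrossing Ttri ST S'T); exists a, x, b, y, c.
Qed.

Lemma tri_next i j : j = i.+1 :> nat -> H i j.
Proof.
move=> ij; have lij : (i < j)%N by rewrite ij.
have [/(tri_hat lij)//|[S [_ [a [c [e [[_ ic cj _] _ _ _]]]]]]] := tri_edge_or_crossed Ttri lij.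
by move: cj; rewrite ij ltnS leqNgt ic.
Qed.

(** If ad is not an edge, it is pierced by a triangle with middle vertex x; that triangle is also
    pierced by ac if x > c fails strictly on the left, that is x < c, and by bd if x >= c. *)
Lemma tri_X a b c d : (a < b)%N -> (b < c)%N -> (c < d)%N -> H a c -> H b d -> H a d.
Proof.
move=> ab bc cd ac bd; have ad := ltn_trans ab (ltn_trans bc cd).
have [/(tri_hat ad)//|[S [ST [a' [x [e [[a'a ax xd de] a'S xS eS]]]]]]] :=
  tri_edge_or_crossed Ttri ad.
have [xc|cx] := ltnP x c.
  by case: (tri_no_cross ST a'S xS eS a'a ax xc (ltn_trans cd de) ac).
by case: (tri_no_cross ST a'S xS eS (ltn_trans a'a ab) (leq_trans bc cx) xd de bd).
Qed.

Lemma tri_third S v w : S \in T -> exists2 x : V, x \in S & (x != v) && (x != w).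
Proof.
move=> ST; have : S :\: [set v; w] != set0.
  apply: contraTneq isT => e; have := tri_card Ttri ST.
  rewrite -(cardsID [set v; w] S) e cards0 addn0 => h.
  have := subset_leq_card (subsetIr S [set v; w]); rewrite h cards2; by case: (_ != _).
by case/set0Pn => x; rewrite !inE negb_or => /andP[h xS]; exists x.
Qed.

Definition face a b c : bool := [exists S in T, [&& a \in S, b \in S & c \in S]].

Lemma faceP a b c : reflect (exists2 S, S \in T & [/\ a \in S, b \in S & c \in S]) (face a b c).
Proof.
apply: (iffP existsP) => [[S /andP[ST /and3P[? ? ?]]]|[S ST [aS bS cS]]]; first by exists S.
by exists S; rewrite ST aS bS cS.
Qed.

(* In each of the next three lemmas an extremal choice of the third vertex of a
   face on vw forces the cofacet on one of its sides to provide the new vertex. *)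
Lemma face_mid v w : (v.+1 < w)%N -> H v w ->
  exists x : V, [/\ (v < x)%N, (x < w)%N & face v x w].
Proof.
move=> vw /(tri_hat (ltnW vw))[S ST [vS wS]]; have vw' := ltnW vw.
have e : (inord v.+1 : V) = v.+1 :> nat by rewrite inordK //; have := ltn_ord w; lia.
have [x xS /andP[xv xw]] := tri_third v w ST.
have mid z S' : S' \in T -> v \in S' -> w \in S' -> z \in S' -> (v < z < w)%N ->
    exists x : V, [/\ (v < x)%N, (x < w)%N & face v x w].
  by move=> S'T vS' wS' zS' /andP[vz zw]; exists z; split=> //; apply/faceP; exists S'.
case: (ltngtP x v) xv => [x_v _|vx _|/val_inj->]; last by rewrite eqxx.
  (* With u least, the cofacet below uvw has its new vertex before u, against minimality, or between
     v and w. The vertex v+1 shows that a cofacet exists on this side. *)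
  have [|u /andP[uv /faceP[S1 S1T [uS vS1 wS1]]] umin] :=
      @ex_min_ord _ (fun u : V => (u < v)%N && face u v w).
    by exists x; rewrite x_v; apply/faceP; exists S.
  have [|S2 [z [S2T [uS2 vS2 wS2] zS /orP[zu|]]]] :=
      tri_below Ttri (v := inord v.+1) S1T uv vw' uS vS1 wS1.
  - by rewrite e ltnSn vw orbT.
  - have fz : face z v w by apply/faceP; exists S2.
    by have := umin z; rewrite (ltn_trans zu uv) fz leqNgt zu => /(_ isT).
  - exact: mid zS.
case: (ltngtP x w) xw => [x_w _|wx _|/val_inj->]; last by rewrite eqxx.
  by apply: mid xS _; rewrite // vx.
have [|u /andP[wu /faceP[S1 S1T [vS1 wS1 uS]]] umax] :=
    @ex_max_ord _ (fun u : V => (w < u)%N && face v w u).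
  by exists x; rewrite wx; apply/faceP; exists S.
have [|S2 [z [S2T [vS2 wS2 uS2] zS /orP[uz|]]]] :=
    tri_above Ttri (v := inord v.+1) S1T vw' wu vS1 wS1 uS.
- by rewrite e ltnSn vw orbT.
- have fz : face v w z by apply/faceP; exists S2.
  by have := umax z; rewrite (ltn_trans wu uz) fz leqNgt uz => /(_ isT).
- exact: mid zS.
Qed.

Lemma face_left v w : (0 < v)%N -> (v < w)%N -> H v w ->
  exists2 u : V, (u < v)%N & face u v w.
Proof.
move=> v0 vw /(tri_hat vw)[S ST [vS wS]].
have [x xS /andP[xv xw]] := tri_third v w ST.
case: (ltngtP x v) xv => [x_v _|vx _|/val_inj->]; last by rewrite eqxx.
  by exists x => //; apply/faceP; exists S.
case: (ltngtP x w) xw => [x_w _|wx _|/val_inj->]; last by rewrite eqxx.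
  (* With u the last such vertex before w, the cofacet below vuw cannot add a vertex of (u, w), so
     it adds one before v; it exists since 0 lies on that side. *)
  have [|u /and3P[vu uw /faceP[S1 S1T [vS1 uS wS1]]] umax] :=
      @ex_max_ord _ (fun u : V => [&& (v < u)%N, (u < w)%N & face v u w]).
    by exists x; rewrite vx x_w; apply/faceP; exists S.
  have [|S2 [z [S2T [vS2 uS2 wS2] zS /orP[zv|/andP[uz zw]]]]] :=
      tri_below Ttri (v := ord0) S1T vu uw vS1 uS wS1.
  - by rewrite /= v0.
  - by exists z => //; apply/faceP; exists S2.
  - have fz : face v z w by apply/faceP; exists S2.
    by have := umax z; rewrite (ltn_trans vu uz) zw fz leqNgt uz => /(_ isT).
have [|u /andP[wu /faceP[S1 S1T [vS1 wS1 uS]]] umin] :=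
    @ex_min_ord _ (fun u : V => (w < u)%N && face v w u).
  by exists x; rewrite wx; apply/faceP; exists S.
have [|S2 [z [S2T [vS2 wS2 uS2] zS /orP[zv|/andP[wz zu]]]]] :=
    tri_below Ttri (v := ord0) S1T vw wu vS1 wS1 uS.
- by rewrite /= v0.
- by exists z => //; apply/faceP; exists S2.
- have fz : face v w z by apply/faceP; exists S2.
  by have := umin z; rewrite wz fz leqNgt zu => /(_ isT).
Qed.

Lemma tri_middle v w : (0 < v)%N -> (v < w)%N -> (w <= n)%N -> H v w ->
  exists S a d, [/\ S \in T, (a < v)%N, (w < d)%N &
                    [/\ a \in S, v \in S, w \in S & d \in S]].
Proof.
move=> v0 vw wn hvw; have [x xv fx] := face_left v0 vw hvw.
have [|u /andP[uv /faceP[S1 S1T [uS vS1 wS1]]] umax] :=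
    @ex_max_ord _ (fun u : V => (u < v)%N && face u v w).
  by exists x; rewrite xv.
have [|S2 [z [S2T [uS2 vS2 wS2] zS /orP[wz|/andP[uz zv]]]]] :=
    tri_above Ttri (v := ord_max) S1T uv vw uS vS1 wS1.
- by rewrite /= ltnS wn.
- by exists S2, u, z.
- have fz : face z v w by apply/faceP; exists S2.
  by have := umax z; rewrite zv fz leqNgt uz => /(_ isT).
Qed.

(** A neighbour of c strictly between a and b would pierce abd, and a neighbour of b strictly
    between c and d would pierce acd. *)
Lemma tri_mem_xi S a b c d : S \in T -> (a < b)%N -> (b < c)%N -> (c < d)%N ->
  a \in S -> b \in S -> c \in S -> d \in S ->
  [/\ H b c, S = [set a; b; c; d] & xi n (Gamma n T) b c = S].
Proof.
move=> ST ab bc cd aS bS cS dS.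
have edge (x y : V) : (x < y)%N -> x \in S -> y \in S -> H x y.
  by move=> xy xS yS; apply/(tri_hat xy); exists S.
have eS : S = [set a; b; c; d].
  have [a' [b' [c' [d' [ab' bc' cd' eS]]]]] := sort_set4 (tri_card Ttri ST).
  apply/esym/eqP; rewrite eqEcard (tri_card Ttri ST) cards4_lt // leqnn andbT.
  by apply/subsetP => i; rewrite !inE -!orbA => /or4P[] /eqP->.
split=> //; first exact: edge.
rewrite eS; apply: xi_eq => //.
- exact: edge (ltn_trans ab bc) _ _.
- exact: edge (ltn_trans bc cd) _ _.
- by move=> i ai ib; apply: (tri_no_cross ST aS bS dS ai ib bc cd).
- by move=> i ci id; apply: (tri_no_cross ST aS cS dS ab bc ci id).
Qed.

Lemma Gamma_persistent : persistent n (Gamma n T).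
Proof.
split; first exact: graph_on_Gamma.
- move=> i j i0 lin ij; have ij' : j = i.+1 :> nat := ij.
  by rewrite -hat_inner ?ij' //; apply: tri_next.
- move=> a b c d ab bc cd acE bdE.
  have [_ /subsetP inn] := graph_on_Gamma acE; have [_ /subsetP inn'] := graph_on_Gamma bdE.
  have /andP[a0 _] : inner n a by apply: inn; rewrite !inE eqxx.
  have /andP[_ dn] : inner n d by apply: inn'; rewrite !inE eqxx orbT.
  have ac := ltn_trans ab bc; have bd := ltn_trans bc cd.
  rewrite -hat_inner ?(ltn_trans ac) //; apply: (tri_X ab bc cd); rewrite hat_inner //.
    exact: leq_trans (ltnW cd) dn.
  exact: ltn_trans ab.
- move=> a b ab abE; have [_ /subsetP inn] := graph_on_Gamma abE.
  have /andP[a0 _] : inner n a by apply: inn; rewrite !inE eqxx.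
  have /andP[_ bn] : inner n b by apply: inn; rewrite !inE eqxx orbT.
  have [|x [ax xb /faceP[S ST [aS xS bS]]]] := face_mid ab.
    by rewrite hat_inner // ltnW.
  exists x; split=> //; rewrite -hat_inner //.
  + by apply/(tri_hat ax); exists S.
  + exact: leq_trans (ltnW xb) bn.
  + by apply/(tri_hat xb); exists S.
  + exact: ltn_trans ax.
Qed.

(** Every simplex of T is the xi of its two middle vertices; conversely [tri_middle] provides, for
    each edge vw, a simplex of T with these middle vertices. *)
Lemma Xi_Gamma : Xi n (Gamma n T) = T.
Proof.
apply/setP => S; apply/idP/idP => [|ST].
  move=> SX; move: (SX); rewrite inE => /existsP[v /existsP[w /and3P[vw vwE /eqP ->]]].
  have [_ /subsetP inn] := graph_on_Gamma vwE.
  have /andP[v0 _] : inner n v by apply: inn; rewrite !inE eqxx.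
  have /andP[_ wn] : inner n w by apply: inn; rewrite !inE eqxx orbT.
  have [|S' [a [d [S'T av wd [aS vS wS dS]]]]] := tri_middle v0 vw wn.
    by rewrite hat_inner.
  by have [_ _ ->] := tri_mem_xi S'T av vw wd aS vS wS dS.
have [a [b [c [d [ab bc cd eS]]]]] := sort_set4 (tri_card Ttri ST).
have [aS bS cS dS] : [/\ a \in S, b \in S, c \in S & d \in S].
  by rewrite eS !inE !eqxx !orbT.
have [hbc _ exi] := tri_mem_xi ST ab bc cd aS bS cS dS.
rewrite inE; apply/existsP; exists b; apply/existsP; exists c.
rewrite bc exi eqxx andbT /= -hat_inner //; first exact: leq_trans ab.
by rewrite -ltnS (leq_trans cd) // -ltnS.
Qed.

End Recover.

End MomentCurve.

Theorem theorem13 (R : realType) (n : nat) (t : 'I_(n.+2) -> R) :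
  (2 <= n)%N ->
  (forall i j : 'I_(n.+2), (i < j)%N -> (t i < t j)%R) ->
  [/\ forall T, triangulation t T -> persistent n (Gamma n T),
      forall E, persistent n E -> triangulation t (Xi n E),
      forall T, triangulation t T -> Xi n (Gamma n T) = T
    & forall E, persistent n E -> Gamma n (Xi n E) = E].
Proof.
move=> n2 t_lt; split.
- by move=> T Ttri; apply: Gamma_persistent Ttri.
- by move=> E Epers; apply: Xi_triangulation.
- by move=> T Ttri; apply: Xi_Gamma Ttri.
- by move=> E Epers; apply: Gamma_Xi.
Qed.
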